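(* Let $X$ be a positive definite metric space with similarity embedding $\varphi$ and let $S=\varphi(X)$. Then $$|X| \,=\, \frac{1}{1-2R(S)^2}.$$
   Context: Metric spaces $(X,d)$ are finite and nonempty; $n=\#X$. The similarity matrix $Z=Z(X)\in\mathbb{R}^{X\times X}$ has entries $z_{ij}=e^{-d(i,j)}$. $X$ is positive definite if $Z$ is a positive definite matrix. A weighting on $X$ is a vector $\mathbf{w}\in\mathbb{R}^X$ with $Z\mathbf{w}=\mathbf{1}$ (all-ones vector), and the magnitude is $|X|=\mathbf{1}^T\mathbf{w}$ for any weighting; for positive definite $X$, $\mathbf{w}=Z^{-1}\mathbf{1}$ is unique and $|X|=\mathbf{1}^TZ^{-1}\mathbf{1}$. A similarity embedding of a positive definite $X$ is a map $\varphi:X\to\mathbb{R}^{n-1}$ with $\|\varphi(i)-\varphi(j)\|^2=1-e^{-d(i,j)}$ for all $i,j\in X$; it exists, is unique up to isometries of $\mathbb{R}^{n-1}$, and its image $S=\varphi(X)$ is the set of vertices of a simplex ($n$ affinely independent points). The circumradius $R(S)$ is the radius of the unique sphere in $\mathbb{R}^{n-1}$ passing through all points of $S$ (equal to $0$ if $n=1$). *)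

(* Defs.v *)
From HB Require Import structures.
From mathcomp Require Import all_boot all_order all_algebra.
From mathcomp Require Import all_classical all_reals all_analysis.

Set Implicit Arguments.
Unset Strict Implicit.
Unset Printing Implicit Defensive.

Import Order.TTheory GRing.Theory Num.Theory.
Import numFieldNormedType.Exports.

Local Open Scope classical_set_scope.
Local Open Scope ring_scope.

#[short(type="finMetricType")]
HB.structure Definition FinMetric (R : numDomainType) :=
  { X of Finite X & Metric R X }.

Section Magnitude.
Context {R : realType}.

(* R^X is represented by column vectors indexed by the enumeration of X. *)
Definition similarity_matrix (X : finMetricType R) : 'M[R]_(#|{: X}|) :=
  \matrix_(i, j) expR (- mdist (enum_val i) (enum_val j)).

Definition posdef_mx n (A : 'M[R]_n) : Prop :=
  A^T = A /\ forall v : 'cV[R]_n, v != 0 -> 0 < (v^T *m A *m v) 0 0.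

Definition positive_definite (X : finMetricType R) : Prop :=
  posdef_mx (similarity_matrix X).

Definition weighting (X : finMetricType R) : set 'cV[R]_(#|{: X}|) :=
  [set w | similarity_matrix X *m w = const_mx 1].
Arguments weighting X : clear implicits.

(* The value does not depend on the weighting: see [magnitudeE]. If X has no
   weighting, the magnitude takes the irrelevant value 0. *)
Definition magnitude (X : finMetricType R) : R :=
  ((const_mx 1 : 'cV[R]_(#|{: X}|))^T *m xget 0 (weighting X)) 0 0.

(* The norm of the library on 'rV[R]_m is the sup norm, not the Euclidean one. *)
Definition norm2 m (x : 'rV[R]_m) : R := Num.sqrt (\sum_i x 0 i ^+ 2).

Definition similarity_embedding (X : finMetricType R)
    (phi : X -> 'rV[R]_(#|{: X}|.-1)) : Prop :=
  forall i j : X, norm2 (phi i - phi j) ^+ 2 = 1 - expR (- mdist i j).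

Definition sphere m (c : 'rV[R]_m) (r : R) : set 'rV[R]_m :=
  [set x | norm2 (x - c) = r].

(* Meaningful when exactly one sphere of the ambient space contains S, e.g. when
   S consists of m + 1 affinely independent points; in dimension 0 this sphere
   is a point, of radius 0. *)
Definition circumradius m (S : set 'rV[R]_m) : R :=
  xget 0 [set r | exists c, S `<=` sphere c r].

Lemma similarity_matrix_tr (X : finMetricType R) :
  (similarity_matrix X)^T = similarity_matrix X.
Proof. by apply/matrixP => i j; rewrite !mxE metric_sym. Qed.

Lemma magnitudeE (X : finMetricType R) (w : 'cV[R]_(#|{: X}|)) :
  weighting X w -> magnitude X = ((const_mx 1 : 'cV[R]_(#|{: X}|))^T *m w) 0 0.
Proof.
move=> Zw; rewrite /magnitude.
have /= Zv : weighting X (xget 0 (weighting X)) by exact: xgetPex (ex_intro _ w Zw).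
move: (xget _ _) Zv => v Zv.
rewrite -[in LHS]Zw trmx_mul similarity_matrix_tr -mulmxA Zv.
by rewrite -[RHS]trace_mx11 -mxtrace_tr trace_mx11 trmx_mul trmxK.
Qed.

Lemma posdef_weighting (X : finMetricType R) : positive_definite X ->
  weighting X = [set invmx (similarity_matrix X) *m const_mx 1].
Proof.
move=> [_ Zpos]; have Zunit : similarity_matrix X \in unitmx.
  rewrite -row_free_unit -kermx_eq0; apply/rowV0P => u /sub_kermxP uZ.
  apply/eqP/negPn/negP => u0; have := Zpos u^T.
  by rewrite trmxK uZ mul0mx mxE ltxx trmx_eq0 => /(_ u0).
apply/seteqP; split=> w /= => [<-|->]; first by rewrite mulKmx.
by rewrite /weighting /= mulKVmx.
Qed.

Lemma sphere_radius_ge0 m (S : set 'rV[R]_m) (c : 'rV[R]_m) (r : R) :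
  S !=set0 -> S `<=` sphere c r -> 0 <= r.
Proof. by move=> [x Sx] /(_ x Sx) <-; exact: sqrtr_ge0. Qed.

End Magnitude.

(* Main.v *)
Require Import Defs.
From HB Require Import structures.
From mathcomp Require Import all_boot all_order all_algebra.
From mathcomp Require Import all_classical all_reals all_analysis.
From mathcomp Require Import ring lra.

Set Implicit Arguments.
Unset Strict Implicit.
Unset Printing Implicit Defensive.

Import Order.TTheory GRing.Theory Num.Theory.
Import numFieldNormedType.Exports.

Local Open Scope classical_set_scope.
Local Open Scope ring_scope.

(** The idea is that the similarity matrix [Z] is, up to the factor 1/2, the
    Gram form of the embedded points on the vectors of coordinate sum zero:
    [|sum_i v_i phi(i)|^2 = (v^T Z v) / 2] whenever [sum_i v_i = 0]
    ([norm2_zero_sum_comb]). This is the polarised form of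
    [|phi(i) - phi(j)|^2 = 1 - Z_ij], and the whole theorem is read off it.

    Since [Z] is positive definite, the form shows that the [n] points are
    affinely independent, so that every point [c] of the ambient space, of
    dimension [n - 1], has barycentric coordinates [v] with respect to them
    ([barycentric_coord_exists]). Applied to [e_i - v] it gives
    [|phi(i) - c|^2 = (1 + v^T Z v) / 2 - (Z v)_i]
    ([norm2_vertex_sub_barycenter]). Hence [c] is equidistant from all the
    points exactly when [Z v] is a constant vector, that is, when [v] is a
    multiple of the weighting: the circumcentre is the point whose barycentric
    coordinates are the normalised weighting. If [Z v = k 1] with [v] of sum 1,
    then [v^T Z v = k], so the common squared distance is
    [r^2 = (1 + k) / 2 - k], which says [k = 1 - 2 r^2]; and [v / k] is a
    weighting, so the magnitude is [1 / k].

    The two directions are used separately: the normalised weighting provides a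
    circumscribed sphere ([circumscribed_sphere_exists]), and any circumscribed
    sphere has the radius asserted by the theorem
    ([weighting_of_circumscribed_sphere]). *)

Lemma subr_mxE (V : zmodType) m n (A B : 'M[V]_(m, n)) i j :
  (A - B) i j = A i j - B i j.
Proof. by rewrite !mxE. Qed.

Lemma norm2_sqr (R : realType) m (x : 'rV[R]_m) :
  norm2 x ^+ 2 = (x *m x^T) 0 0.
Proof.
rewrite sqr_sqrtr; last by apply: sumr_ge0 => i _; exact: sqr_ge0.
by rewrite !mxE; apply: eq_bigr => i _; rewrite !mxE expr2.
Qed.

(** The points are the rows of [P], so that the combination of the points with
    coefficients [v] is the product [v^T *m P]. *)
Definition embeds_similarity (R : realType) n m (Z : 'M[R]_n)
    (P : 'M[R]_(n, m)) :=
  forall i j, norm2 (row i P - row j P) ^+ 2 = 1 - Z i j.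

Lemma embeds_similarity_diag (R : realType) n m (Z : 'M[R]_n)
    (P : 'M[R]_(n, m)) i :
  embeds_similarity Z P -> Z i i = 1.
Proof.
move=> /(_ i i); rewrite subrr norm2_sqr mul0mx mxE => /esym/eqP.
by rewrite subr_eq0 => /eqP.
Qed.

(** The polarisation identity, with [g] the vector of the squared norms of the
    points: all the terms besides [Z] have a factor [const_mx 1], on the left or
    on the right. *)
Lemma gram_polarisation (R : realType) n m (Z : 'M[R]_n) (P : 'M[R]_(n, m))
    (g := \col_i (P *m P^T) i i) (one := const_mx 1 : 'cV[R]_n) :
  embeds_similarity Z P ->
  2 *: (P *m P^T) = g *m one^T + one *m (g - one)^T + Z.
Proof.
move=> PZ; apply/matrixP => i j; have := PZ i j.
have rowE a b : (row a P *m (row b P)^T) 0 0 = (P *m P^T) a b.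
  by rewrite !mxE; apply: eq_bigr => k _; rewrite !mxE.
have symP : (P *m P^T) j i = (P *m P^T) i j.
  by rewrite -[in LHS](trmxK P) -trmx_mul trmxK mxE.
rewrite norm2_sqr linearB /= mulmxBl !mulmxBr.
rewrite !subr_mxE !rowE symP => PZij.
rewrite /g /one; move: (P *m P^T) PZij => G Gij.
rewrite !mxE !big_ord1 !mxE; lra.
Qed.

(** Pairing [gram_polarisation] with a vector of sum zero on both sides kills
    the two terms that contain [const_mx 1]. *)
Lemma norm2_zero_sum_comb (R : realType) n m (Z : 'M[R]_n) (P : 'M[R]_(n, m))
    (v : 'cV[R]_n) :
  embeds_similarity Z P -> v^T *m const_mx 1 = 0 :> 'M[R]_1 ->
  norm2 (v^T *m P) ^+ 2 = (v^T *m Z *m v) 0 0 / 2.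
Proof.
move=> /gram_polarisation; set g := (\col_i _) => GZ v0.
have v0' : (const_mx 1 : 'cV[R]_n)^T *m v = 0.
  by rewrite -[v]trmxK -trmx_mul v0 trmx0.
have : v^T *m (2 *: (P *m P^T)) *m v = v^T *m Z *m v.
  rewrite GZ !mulmxDr !mulmxDl -!mulmxA v0' !mulmx0 add0r.
  by rewrite [v^T *m (const_mx 1 *m _)]mulmxA v0 mul0mx add0r.
rewrite -scalemxAr -scalemxAl => <-.
by rewrite norm2_sqr trmx_mul trmxK !mulmxA [in RHS]mxE mulrC mulKf.
Qed.

Lemma posdef_mx_ker (R : realType) n (Z : 'M[R]_n) (v : 'cV[R]_n) :
  posdef_mx Z -> (v^T *m Z *m v) 0 0 = 0 -> v = 0.
Proof.
move=> [_ Zpos] vZv; apply/eqP/negPn/negP => /Zpos.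
by rewrite vZv ltxx.
Qed.

(** Appending a coordinate 1 to the points turns affine independence into linear
    independence; the resulting matrix is square, so its rows also span. *)
Lemma barycentric_coord_exists (R : realType) n m (Z : 'M[R]_n)
    (P : 'M[R]_(n, m)) (c : 'rV[R]_m) :
  n = m.+1 -> posdef_mx Z -> embeds_similarity Z P ->
  exists2 v : 'cV[R]_n, v^T *m const_mx 1 = 1%:M :> 'M[R]_1 & c = v^T *m P.
Proof.
move=> nm Zpos PZ; set A := row_mx P (const_mx 1 : 'cV[R]_n).
have freeA : row_free A.
  rewrite -kermx_eq0; apply/rowV0P => u /sub_kermxP.
  rewrite mul_mx_row -(row_mx0 R 1 m 1) => /eq_row_mx[uP u1].
  apply: trmx_inj; rewrite trmx0; apply: (posdef_mx_ker Zpos).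
  have := norm2_zero_sum_comb (v := u^T) PZ; rewrite trmxK => /(_ u1).
  rewrite uP norm2_sqr mul0mx mxE => /esym/eqP.
  by rewrite mulf_eq0 invr_eq0 pnatr_eq0 orbF => /eqP.
have fullA : row_full A by rewrite /row_full (eqP freeA) nm addn1.
have /submxP[u] := submx_full (row_mx c 1%:M) fullA.
rewrite mul_mx_row => /eq_row_mx[uP u1].
by exists u^T; rewrite trmxK.
Qed.

(** The difference [e_i - v] of two vectors of sum 1 has sum zero, so
    [norm2_zero_sum_comb] applies to it; the summand 1 is [Z_ii]. *)
Lemma norm2_vertex_sub_barycenter (R : realType) n m (Z : 'M[R]_n)
    (P : 'M[R]_(n, m)) (v : 'cV[R]_n) i :
  Z^T = Z -> embeds_similarity Z P -> v^T *m const_mx 1 = 1%:M :> 'M[R]_1 ->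
  norm2 (row i P - v^T *m P) ^+ 2
    = (1 + (v^T *m Z *m v) 0 0) / 2 - (Z *m v) i 0.
Proof.
move=> Zsym PZ v1.
pose e : 'cV[R]_n := delta_mx i 0.
have eP k (B : 'M[R]_(n, k)) : e^T *m B = row i B by rewrite trmx_delta -rowE.
rewrite -eP -mulmxBl -linearB /= (norm2_zero_sum_comb PZ); last first.
  rewrite linearB /= mulmxBl v1 eP.
  by apply/matrixP => a b; rewrite !mxE !ord1 subrr.
have vZe : v^T *m Z *m e = (row i (Z *m v))^T.
  by rewrite -eP !trmx_mul trmxK Zsym.
have eZe : e^T *m Z *m e = (Z i i)%:M.
  by rewrite eP -colE; apply/matrixP => a b; rewrite !mxE !ord1 eqxx.
rewrite [(e - v)^T]linearB /= !mulmxBl !mulmxBr vZe eZe -mulmxA eP.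
rewrite !subr_mxE (embeds_similarity_diag _ PZ).
have -> : (row i (Z *m v)) 0 0 = (Z *m v) i 0 by rewrite mxE.
have -> : (row i (Z *m v))^T 0 0 = (Z *m v) i 0 by rewrite 2!mxE.
have -> : (1%:M : 'M[R]_1) 0 0 = 1 by rewrite mxE.
by field.
Qed.

(** The centre is the barycentre of the points for the normalised weighting. The
    total weight can be normalised because it equals [w^T Z w > 0]. *)
Lemma circumscribed_sphere_exists (R : realType) n m (Z : 'M[R]_n)
    (P : 'M[R]_(n, m)) (w : 'cV[R]_n) :
  (0 < n)%N -> posdef_mx Z -> embeds_similarity Z P -> Z *m w = const_mx 1 ->
  exists r c, forall i, norm2 (row i P - c) = r.
Proof.
move=> n0 Zpos PZ Zw; have [Zsym _] := Zpos.
set W := (w^T *m Z *m w) 0 0.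
have W0 : W != 0.
  apply/eqP => /(posdef_mx_ker Zpos) w0; move: Zw; rewrite w0 mulmx0.
  by move=> /matrixP/(_ (Ordinal n0) 0)/eqP; rewrite !mxE eq_sym oner_eq0.
have wW : w^T *m const_mx 1 = W%:M :> 'M[R]_1.
  by rewrite -Zw mulmxA [LHS]mx11_scalar.
pose v := W^-1 *: w.
have v1 : v^T *m const_mx 1 = 1%:M :> 'M[R]_1.
  by rewrite /v linearZ /= -scalemxAl wW scale_scalar_mx mulVf.
have Zv : Z *m v = const_mx W^-1.
  by rewrite /v -scalemxAr Zw scalemx_const mulr1.
pose rr i := norm2 (row i P - v^T *m P).
exists (rr (Ordinal n0)), (v^T *m P) => i.
apply/eqP; rewrite -(@eqrXn2 _ 2) ?sqrtr_ge0 // /rr.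
by rewrite !(norm2_vertex_sub_barycenter _ Zsym PZ v1) Zv !mxE.
Qed.

(** The barycentric coordinates of the centre of any circumscribed sphere are
    proportional to a weighting, because the distances from the centre to the
    points agree exactly when the entries of [Z *m v] do. The total weight then
    pins down [r], the same for every circumscribed sphere. *)
Lemma weighting_of_circumscribed_sphere (R : realType) n m (Z : 'M[R]_n)
    (P : 'M[R]_(n, m)) (c : 'rV[R]_m) (r : R) :
  n = m.+1 -> posdef_mx Z -> embeds_similarity Z P ->
  (forall i, norm2 (row i P - c) = r) ->
  exists2 w : 'cV[R]_n, Z *m w = const_mx 1 &
    ((const_mx 1 : 'cV[R]_n)^T *m w) 0 0 = 1 / (1 - 2 * r ^+ 2).
Proof.
move=> nm Zpos PZ Pr; have [Zsym _] := Zpos.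
have [v v1 cE] := barycentric_coord_exists c nm Zpos PZ.
set q := (v^T *m Z *m v) 0 0.
have Zv : Z *m v = const_mx ((1 + q) / 2 - r ^+ 2).
  apply/matrixP => i j; rewrite ord1 [RHS]mxE -(Pr i) cE.
  by rewrite (norm2_vertex_sub_barycenter _ Zsym PZ v1) -/q; ring.
(* The weights sum to 1, so pairing the constant vector [Z v] with [v] gives
   back its constant, which makes the previous equation linear in [q]. *)
have qE : q = (1 + q) / 2 - r ^+ 2.
  rewrite {1}/q -mulmxA Zv -[X in const_mx X]mulr1 -scalemx_const.
  by rewrite -scalemxAr v1 !mxE eqxx mulr1.
have kE : 1 - 2 * r ^+ 2 = q by lra.
rewrite -qE in Zv.
have q0 : q != 0.
  apply/eqP => /(posdef_mx_ker Zpos) v0; move: v1.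
  rewrite v0 trmx0 mul0mx => /matrixP/(_ 0 0)/eqP.
  by rewrite !mxE eqxx eq_sym oner_eq0.
exists (q^-1 *: v).
  by rewrite -scalemxAr Zv scalemx_const mulVf.
rewrite kE -scalemxAr mxE -[v]trmxK -trmx_mul v1 !mxE eqxx mulr1.
by rewrite div1r.
Qed.

Theorem theorem2p12 (R : realType) (X : finMetricType R)
    (phi : X -> 'rV[R]_(#|{: X}|.-1)) :
  (0 < #|{: X}|)%N -> positive_definite X -> similarity_embedding phi ->
  magnitude X = 1 / (1 - 2 * circumradius (range phi) ^+ 2).
Proof.
move=> X0 Zpos phiZ.
pose P : 'M[R]_(#|{: X}|, _) := \matrix_i phi (enum_val i).
have PZ : embeds_similarity (similarity_matrix X) P.
  by move=> i j; rewrite !rowK phiZ mxE.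
have sphereE c r :
    range phi `<=` sphere c r <-> forall i, norm2 (row i P - c) = r.
  split=> [Sr i|Pr _ [x _ <-]].
    by rewrite rowK; apply: Sr; exists (enum_val i).
  by rewrite /sphere /= -(Pr (enum_rank x)) rowK enum_rankK.
have [w Zw] : @weighting R X !=set0.
  rewrite posdef_weighting //.
  by exists (invmx (similarity_matrix X) *m const_mx 1).
have [r0 [c0 Pr0]] := circumscribed_sphere_exists X0 Zpos PZ Zw.
have [c /sphereE Pr] :
    exists c, range phi `<=` sphere c (circumradius (range phi)).
  rewrite /circumradius.
  apply: (@xgetPex _ 0 [set r | exists c, range phi `<=` sphere c r]).
  by exists r0, c0; apply/sphereE.
have [u Zu <-] :=
  weighting_of_circumscribed_sphere (esym (prednK X0)) Zpos PZ Pr.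
exact: magnitudeE.
Qed.
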